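(* The sequence $(f_n)_{n\ge 0}$ defined by $f_0=0$ and $f_n=\log n$ (natural logarithm) for $n\ge 1$ is not holonomic.
   Context: A sequence $(f_n)_{n\ge0}$ of complex numbers is called holonomic (or $P$-recursive) if there exist an integer $d\ge 0$ and polynomials $p_0,\dots,p_d\in\mathbb{C}[X]$, not all zero, such that $p_0(n)f_{n+d}+p_1(n)f_{n+d-1}+\cdots+p_d(n)f_n=0$ for all integers $n\ge 0$. *)

(* Defs.v *)
From HB Require Import structures.
From mathcomp Require Import all_boot all_order all_algebra.
From mathcomp Require Import complex.
From mathcomp Require Import reals exp.

Set Implicit Arguments.
Unset Strict Implicit.
Unset Printing Implicit Defensive.

Import Order.TTheory GRing.Theory Num.Theory.
Local Open Scope ring_scope.
Local Open Scope complex_scope.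

(* [p i] is the coefficient of f_{n+d-i}; the indices i range over 0, ..., d,
   so the truncated subtraction [d - i] is exact. No single coefficient, in
   particular neither [p 0] nor [p d], is required to be nonzero. *)
Definition holonomic (R : realType) (f : nat -> R[i]) : Prop :=
  exists (d : nat) (p : 'I_d.+1 -> {poly R[i]}),
    (exists i : 'I_d.+1, p i != 0) /\
    forall n : nat,
      \sum_(i < d.+1) (p i).[n%:R] * f (n + (d - i))%N = 0.

Definition log_seq (R : realType) (n : nat) : R[i] :=
  if n == 0%N then 0 else (ln (n%:R : R))%:C.

(* Main.v *)
(* Separating real and imaginary parts, a recurrence makes a function
   F(x) = sum_j p_j(x) log(x + a_j) + r(x), with real polynomials p_j and r
   rational (initially 0), vanish at all positive integers. By Rolle's theorem
   F' again has arbitrarily large zeros, and it has the same shape with p_j'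
   in place of p_j; by induction on the degrees every p_j is a constant. Then
   F' is a rational function with infinitely many zeros, so
   r' = - sum_j p_j / (x + a_j), and every p_j is 0 because the derivative of
   a rational function has no residues. *)

Require Import Defs.
From mathcomp Require Import all_boot all_order all_algebra.
From mathcomp Require Import complex.
From mathcomp Require Import reals exp.
From mathcomp Require Import boolp functions topology normedtype derive realfun.
From mathcomp Require Import polyrcf ring.

Set Implicit Arguments.
Unset Strict Implicit.
Unset Printing Implicit Defensive.

Import Order.TTheory GRing.Theory Num.Theory.
Import numFieldNormedType.Exports.
Local Open Scope ring_scope.

Definition unbounded_zeros (R : realType) (f : R -> R) : Prop :=
  forall M, exists2 x, M < x & f x = 0.

Lemma unbounded_zeros_poly (R : realType) (p : {poly R}) :
  unbounded_zeros (horner p) -> p = 0.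
Proof.
move=> p0; apply/eqP/negPn/negP => pn0.
have [x xM /(cauchy_boundP pn0)] := p0 (cauchy_bound p).
by rewrite ltNge (le_trans (ltW xM)) ?ler_norm.
Qed.

Lemma unbounded_zeros_derive (R : realType) (f df : R -> R) :
    (forall x : R, 0 < x -> is_derive x 1 f (df x)) ->
  unbounded_zeros f -> unbounded_zeros df.
Proof.
move=> fdf f0 M.
(* The maximum with [0] keeps both zeros in the half-line where [f] is differentiable. *)
have [a Ma fa] := f0 (Num.max M 0).
have [b ab fb] := f0 a.
move: Ma; rewrite gt_max => /andP[Ma a0].
have [x|||c /[!in_itv]/= /andP[ac _] fc] := @Rolle R f a b ab.
- rewrite in_itv /= => /andP[ax _].
  by case: (fdf x (lt_trans a0 ax)).
- apply: derivable_within_continuous => x /[!in_itv]/= /andP[ax _].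
  by case: (fdf x (lt_le_trans a0 ax)).
- by rewrite fa fb.
exists c; first exact: lt_trans ac.
by rewrite -(@derive_val _ _ _ _ _ _ _ (fdf c (lt_trans a0 ac))) derive_val.
Qed.

(* The identity says that the sum of the [p i / ('X - b i)] is [- (u / v)'],
   with denominators cleared. *)
Lemma residue_derive0 (F : numFieldType) (I : finType) (b : I -> F)
    (p : I -> {poly F}) (u v : {poly F}) : injective b -> v != 0 ->
    (u^`() * v - u * v^`()) * \prod_i ('X - (b i)%:P)
      + v ^+ 2 * \sum_i p i * \prod_(j | j != i) ('X - (b j)%:P) = 0 ->
  forall i, (p i).[b i] = 0.
Proof.
move=> bI v0 + i.
rewrite [\prod_i0 ('X - _)](bigD1 i) //= [\sum_i0 _](bigD1 i) //=.
set X := 'X - (b i)%:P; set E := \prod_(j | _) _; set S := \sum_(j | _) _.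
have X0 : X != 0 by rewrite polyXsubC_eq0.
have Xb : X.[b i] = 0 by rewrite hornerXsubC subrr.
have X1 : X^`() = 1 by rewrite derivXsubC.
have Eb : E.[b i] != 0.
  rewrite horner_prod; apply/prodf_neq0 => j ji.
  by rewrite hornerXsubC subr_eq0 (inj_eq bI) eq_sym.
(* Each summand of [S] has [j != i], so its product still contains the factor [X]. *)
have [G ->] : exists G, S = X * G.
  exists (\sum_(j | j != i) p j * \prod_(k | (k != j) && (k != i)) ('X - (b k)%:P)).
  rewrite mulr_sumr; apply: eq_bigr => j ji.
  by rewrite (bigD1 i) 1?eq_sym //= mulrCA.
(* Extract the powers of [X] from [u] and [v]. If [u] is zero, so is its cofactor [s], a case
   treated apart below. *)
have [k [s us0 Eu]] := multiplicity_XsubC u (b i).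
move: us0; rewrite Eu -/X mulf_eq0 expf_eq0 (negPf X0) andbF orbF => us0.
have [m [w]] := multiplicity_XsubC v (b i); rewrite v0 /= => /negPf wb ->.
rewrite -/X; clearbody X E => eq0.
have dX n : X * (X ^+ n)^`() = X ^+ n *+ n.
  rewrite deriv_exp X1 mul1r; case: n => [|n] /=; first by rewrite !mulr0n mulr0.
  by rewrite mulrnAr exprS.
(* [k - m] is the order of [u / v] at [b i]: the order of [(u / v)'] is
   [k - m - 1] if [k != m] and nonnegative if [k = m], so it is never [-1]. *)
have {dX}eq0 : X ^+ (k + m) * ((X * (s^`() * w - s * w^`())
      + (s * w) *+ k - (s * w) *+ m) * E)
    + X ^+ (m + m) * (w ^+ 2 * (p i * E + X * G)) = 0.
  rewrite -{}[RHS]eq0 !derivM !exprD -![(s * w) *+ _]mulr_natr.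
  move: (dX k) (dX m); rewrite -![X ^+ _ *+ _]mulr_natr => ek em.
  transitivity ((X * (s^`() * w - s * w^`()) * X ^+ k * X ^+ m
    + s * w * (X ^+ k * k%:R) * X ^+ m - s * w * X ^+ k * (X ^+ m * m%:R)) * E
    + X ^+ m * X ^+ m * (w ^+ 2 * (p i * E + X * G))); first by ring.
  by rewrite -ek -em; ring.
set A := (_ * E : {poly F}) in eq0; set B := (w ^+ 2 * _) in eq0.
have cancelX a (c : {poly F}) : X ^+ a * c = 0 -> c.[b i] = 0.
  by move=> /eqP; rewrite mulf_eq0 expf_eq0 (negPf X0) andbF => /eqP ->; rewrite horner0.
have Ab : A.[b i] = ((s.[b i] * w.[b i]) *+ k - (s.[b i] * w.[b i]) *+ m) * E.[b i].
  by rewrite /A !(hornerE, hornerMn) Xb mul0r add0r.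
have pB : B.[b i] = 0 -> (p i).[b i] = 0.
  move=> /eqP; rewrite /B !hornerE Xb mul0r addr0 !mulf_eq0 -rootE wb (negPf Eb).
  by rewrite /= orbF => /eqP.
have [s0|sn0] := eqVneq s 0.
  have A0 : A = 0 by rewrite /A s0 deriv0 !(mul0r, mul0rn, subrr, mulr0, addr0).
  by apply/pB/(cancelX (m + m)%N); rewrite -[RHS]eq0 A0 mulr0 add0r.
clearbody A B.
(* Divide [eq0] by the lower power of [X] and evaluate at [b i]. If [k < m], a nonzero multiple of
   [s w E] would vanish there, impossible in characteristic 0; if [m < k], only [B] survives; if
   [k = m], [A] already vanishes at [b i]. *)
have [km|mk|km] := ltngtP k m.
- have : A.[b i] = 0.
    have /cancelX : X ^+ (k + m) * (A + X ^+ (m - k) * B) = 0.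
      by rewrite mulrDr mulrA -exprD addnAC subnKC // ltnW.
    by rewrite hornerD hornerM horner_exp Xb expr0n subn_eq0 leqNgt km mul0r addr0.
  move/eqP; rewrite Ab -opprB -mulrnBr ?(ltnW km) // mulNr oppr_eq0 mulf_eq0.
  rewrite (negPf Eb) orbF mulrn_eq0 subn_eq0 leqNgt km /= mulf_eq0 -!rootE wb orbF.
  by move: us0; rewrite sn0 /= => /negPf ->.
- apply: pB.
  have /cancelX : X ^+ (m + m) * (X ^+ (k - m) * A + B) = 0.
    by rewrite mulrDr mulrA -exprD -addnA subnKC ?(ltnW mk) // addnC.
  by rewrite hornerD hornerM horner_exp Xb expr0n subn_eq0 leqNgt mk mul0r add0r.
- apply: pB; move: eq0; rewrite km -mulrDr => /cancelX.
  by rewrite hornerD Ab km subrr mul0r add0r.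
Qed.

(** The term [u / v] makes the shape stable under differentiation; since [0 <= a i], the new
    denominators stay nonzero on the positive half-line. *)
Lemma log_linear_independence (R : realType) (d : nat) (a : 'I_d -> R)
    (p : 'I_d -> {poly R}) (u v : {poly R}) :
    injective a -> (forall i, 0 <= a i) -> (forall x : R, 0 < x -> v.[x] != 0) ->
    unbounded_zeros (fun x => \sum_i (p i).[x] * ln (x + a i) + u.[x] / v.[x]) ->
  forall i, p i = 0.
Proof.
move=> aI a0.
have [n] := ubnP (\sum_i size (p i)); elim: n => // n IH in p u v *.
rewrite ltnS => pn v0 F0.
have [p0|/forallPn[i0 pi0]] := boolP [forall i, p i == 0].
  by move=> i; apply/eqP; exact: (forallP p0).
(* [u' / v'] is the derivative of [u / v] plus the sum of the [p i / (x + a i)], over the common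
   denominator [v ^+ 2 * P]. *)
pose P := \prod_i ('X - (- a i)%:P).
pose S := \sum_i p i * \prod_(j | j != i) ('X - (- a j)%:P).
pose u' := (u^`() * v - u * v^`()) * P + v ^+ 2 * S.
pose v' := v ^+ 2 * P.
have xa0 (x : R) i : 0 < x -> 0 < x + a i by move=> x0; rewrite ltr_wpDr.
have P0 (x : R) : 0 < x -> P.[x] != 0.
  move=> x0; rewrite horner_prod; apply/prodf_neq0 => i _.
  by rewrite hornerXsubC opprK gt_eqF ?xa0.
have v'0 (x : R) : 0 < x -> v'.[x] != 0.
  by move=> x0; rewrite /v' hornerM horner_exp mulf_neq0 ?expf_neq0 ?v0 ?P0.
have SE (x : R) : 0 < x -> S.[x] = P.[x] * \sum_i (p i).[x] / (x + a i).
  move=> x0; rewrite mulr_sumr horner_sum; apply: eq_bigr => i _.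
  rewrite [P](bigD1 i) //= !hornerM hornerXsubC opprK.
  by field; rewrite gt_eqF ?xa0.
have F'0 : unbounded_zeros
    (fun x => \sum_i (p i)^`().[x] * ln (x + a i) + u'.[x] / v'.[x]).
  apply: unbounded_zeros_derive F0 => x x0.
  have -> : (fun x => \sum_i (p i).[x] * ln (x + a i) + u.[x] / v.[x]) =
      \sum_i (horner (p i) * (@ln R \o shift (a i)))
      + horner u * (fun x => (horner v x)^-1).
    by apply/funext => y; rewrite fctE fct_sumE.
  have dln i : is_derive x 1 (@ln R \o shift (a i)) (x + a i)^-1.
    rewrite -[_^-1]mulr1; apply: is_derive1_comp; last exact: is_derive_shift.
    by apply: is_derive1_ln; exact: xa0.
  have dv := is_deriveV (v0 x x0) (is_derive_poly v x).
  apply: (is_derive_eq (is_deriveD (is_derive_sum (fun i =>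
    is_deriveM (is_derive_poly (p i) x) (dln i))) (is_deriveM (is_derive_poly u x) dv))).
  rewrite /u' /v' !(hornerD, hornerN, hornerM, horner_exp) SE // big_split /=.
  rewrite /GRing.scale /= addrAC [RHS]addrC; congr (_ + _); last first.
    by apply: eq_bigr => i _; rewrite mulrC.
  by field; rewrite v0 ?P0.
have p'0 i : (p i)^`() = 0.
  apply: IH v'0 F'0 i; apply: leq_trans pn.
  (* Differentiation shrinks the nonzero [p i0] and enlarges no other [p i]. *)
  rewrite (bigD1 i0) //= [X in (_ < X)%N](bigD1 i0) //= -addSn leq_add //.
    exact: lt_size_deriv.
  apply: leq_sum => i _; have [->|/lt_size_deriv/ltnW//] := eqVneq (p i) 0.
  by rewrite deriv0.
have u'0 : u' = 0.
  apply: unbounded_zeros_poly => M; have [x] := F'0 (Num.max M 0).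
  rewrite gt_max => /andP[Mx x0] F'x; exists x => //.
  move: F'x; rewrite big1 ?add0r => [/eqP|i _]; last by rewrite p'0 horner0 mul0r.
  by rewrite mulf_eq0 invr_eq0 (negPf (v'0 x x0)) orbF => /eqP.
have vn0 : v != 0.
  by apply: contraTneq (v0 1 ltr01) => ->; rewrite horner0 eqxx.
(* [u' = 0] is the residue identity at the distinct points [- a i]; a constant [p i] vanishing there
   is zero. *)
move=> i.
have := residue_derive0 (inj_comp oppr_inj aI) vn0 u'0 i.
have /size1_polyC -> : (size (p i) <= 1)%N.
  by rewrite -subn_eq0 subn1 -polyorder.size_deriv p'0 size_poly0.
by rewrite hornerC => ->.
Qed.

(** Meant for [phi] the real and the imaginary part: a real-linear [phi] passes through the
    relation, because the logarithms and the powers of [n] are real. *)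
Lemma log_relation_part (R : realType) (phi : R[i] -> R) (d : nat)
    (p : 'I_d.+1 -> {poly R[i]}) :
    {morph phi : x y / x + y} -> (forall z r, phi (z * r%:C%C) = phi z * r) ->
    (forall n, \sum_(i < d.+1) (p i).[n%:R] * log_seq R (n + (d - i)) = 0) ->
  forall i k, phi (p i)`_k = 0.
Proof.
move=> phiD phiZ rel i k.
have phi0 : phi 0 = 0 by apply: (addrI (phi 0)); rewrite -phiD !addr0.
pose q i := \poly_(k < size (p i)) phi (p i)`_k.
suff : q i = 0.
  move=> /(congr1 (fun r : {poly R} => r`_k)); rewrite coef_poly coef0.
  by case: ltnP => // /(nth_default 0) ->.
apply: (@log_linear_independence _ _ (fun i : 'I_d.+1 => (d - i)%:R) q 0 1).
- move=> x y /eqP; rewrite eqr_nat => /eqP xy; apply: val_inj => /=.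
  by rewrite -(subKn (ltn_ord x : x <= d)%N) xy subKn // -ltnS.
- by move=> j; rewrite ler0n.
- by move=> x _; rewrite hornerC oner_eq0.
(* The successor also makes [n] positive, so that [log_seq] is in its logarithm branch. *)
move=> M; pose n := (Num.truncn (Num.max M 0)).+1.
exists n%:R.
  by rewrite (le_lt_trans _ (truncnS_gt _)) // le_max lexx.
rewrite horner0 mul0r addr0 -[RHS]phi0 -(rel n) (big_morph phi phiD phi0).
apply: eq_bigr => j _.
rewrite /log_seq addn_eq0 /= phiZ natrD; congr (_ * _).
rewrite horner_poly horner_coef (big_morph phi phiD phi0); apply: eq_bigr => l _.
by rewrite -phiZ rmorphXn /= rmorph_nat.
Qed.

Theorem proposition1 (R : realType) : ~ holonomic (@log_seq R).
Proof.
move=> [d [p [[i /eqP pi0] rel]]]; apply: pi0; apply/polyP => k; rewrite coef0.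
apply/eqP; rewrite eq_complex /=; apply/andP; split; apply/eqP.
- apply: (log_relation_part _ _ rel) => [[x y] [z t]//|[x y] r] /=.
  by rewrite mulr0 subr0.
- apply: (log_relation_part _ _ rel) => [[x y] [z t]//|[x y] r] /=.
  by rewrite mulr0 add0r.
Qed.
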